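(* Let $\Sigma$ be a compact, connected, oriented surface of genus $g$ with exactly one boundary component, $n,k\ge1$, and let $\psi_\Sigma:\mathbf{B}_{n;k}(\Sigma)\to H_\Sigma$ be the epimorphism defined in the context. Let $\beta\cdot h$ denote any action on $h\in H_\Sigma$ by $\beta\in\mathbf{B}_{0,n}(\Sigma)$ that is induced from $\psi_\Sigma$ and satisfies the lifting criteria and the linearity and compatibility condition stated in the context. Then $$\beta\cdot h=h\,\chi(\beta)\,\psi_\Sigma(\beta)$$ for some function $\chi:\mathbf{B}_{0,n}(\Sigma)\to C_{H_\Sigma}(G_\Sigma)$ with the property that $(\chi,\psi_\Sigma):\mathbf{B}_{0,n}(\Sigma)\to C_{H_\Sigma}(G_\Sigma)\rtimes H_\Sigma$ is a homomorphism, where $C_{H_\Sigma}(G_\Sigma)$ is the centralizer of $G_\Sigma$ in $H_\Sigma$ and $H_\Sigma$ acts on it by conjugation, i.e. $(x,u)(y,v)=(x\,uyu^{-1},uv)$.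
   Context: Conventions: $[x,y]=xyx^{-1}y^{-1}$. $\mathbf{B}_{n;k}(\Sigma)$ is the fundamental group of the space of pairs of disjoint subsets of $\Sigma$ with $n$ and $k$ elements; it is the semidirect product of the normal subgroup $\mathbf{B}_{n,k}(\Sigma)$ ($\pi_1$ of the space $B_{n,k}(\Sigma)$ of $k$-element subsets of $\Sigma$ minus $n$ points) and $\mathbf{B}_{0,n}(\Sigma)$ ($\pi_1$ of the space of $n$-element subsets of $\Sigma$), the latter embedded by a splitting $\iota$ of the projection $\mathbf{B}_{n;k}(\Sigma)\to\mathbf{B}_{0,n}(\Sigma)$. It has generators $X_1=\{\bar\sigma_1,\dots,\bar\sigma_{n-1},\bar\mu_1,\dots,\bar\mu_g,\bar\lambda_1,\dots,\bar\lambda_g\}$ (images under $\iota$ of generators of $\mathbf{B}_{0,n}(\Sigma)$) and $X_2=\{\sigma_1,\dots,\sigma_{k-1},\zeta_1,\dots,\zeta_n,\mu_1,\dots,\mu_g,\lambda_1,\dots,\lambda_g\}$ (generators of $\mathbf{B}_{n,k}(\Sigma)$), with relations: (a) among $X_2$: $[\sigma_i,\sigma_j]=1$ for $|i-j|\ge2$; $\sigma_i\sigma_j\sigma_i=\sigma_j\sigma_i\sigma_j$ for $|i-j|=1$; $\mu_r,\lambda_r,\zeta_t$ commute with $\sigma_i$ for $i>1$; $[x,\sigma_1x\sigma_1]=1$ for $x\in\{\mu_r,\lambda_r,\zeta_t\}$; $[x,\sigma_1^{-1}y\sigma_1]=1$ for $x\in\{\mu_r,\lambda_r\},y\in\{\mu_s,\lambda_s\}$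 with $r<s$, for $x\in\{\mu_r,\lambda_r\},y=\zeta_u$, and for $x=\zeta_t,y=\zeta_u$ with $t<u$; $\sigma_1\lambda_r\sigma_1\mu_r\sigma_1=\mu_r\sigma_1\lambda_r$; (b) among $X_1$: the same relations for the barred generators (with $n$ in place of $k$ and no $\zeta$'s); (c) $\bar x^{-1}y\bar x=\bar x_*(y)$ for $\bar x\in X_1,y\in X_2$, where $(\bar\sigma_i)_*$: $\zeta_i\mapsto\zeta_i\zeta_{i+1}\zeta_i^{-1}$, $\zeta_{i+1}\mapsto\zeta_i$; $(\bar\mu_r)_*$: $\zeta_1\mapsto\mu_r\zeta_1\mu_r^{-1}$, $\mu_r\mapsto\mu_r\zeta_1\mu_r\zeta_1^{-1}\mu_r^{-1}$, $\lambda_r\mapsto\lambda_r\mu_r\zeta_1^{-1}\mu_r^{-1}$, $x\mapsto[\mu_r,\zeta_1]x[\mu_r,\zeta_1]^{-1}$ for $x\in\{\mu_s,\lambda_s\}$, $r<s$; $(\bar\lambda_r)_*$: $\zeta_1\mapsto\lambda_r\zeta_1\lambda_r^{-1}$, $\mu_r\mapsto\lambda_r\zeta_1\lambda_r^{-1}\mu_r\zeta_1\lambda_r\zeta_1^{-1}\lambda_r^{-1}$, $\lambda_r\mapsto\lambda_r\zeta_1\lambda_r\zeta_1^{-1}\lambda_r^{-1}$, $x\mapsto[\lambda_r,\zeta_1]x[\lambda_r,\zeta_1]^{-1}$ for $x\in\{\mu_s,\lambda_s\}$, $r<s$; all other generators in $X_2$ are fixed. $H_\Sigma$: for $k\ge2$,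 generators $q,t,\bar m_r,\bar\ell_r,m_r,\ell_r$ ($1\le r\le g$), all commuting except $[m_r,\ell_r]=t^2$, $[\bar m_r,\ell_r]=[m_r,\bar\ell_r]=q$; for $k=1$ the quotient of this group by $t=1$. $\psi_\Sigma$: $\sigma_i\mapsto t$, $\zeta_j\mapsto q$, $\bar\sigma_m\mapsto1$, $\mu_r\mapsto m_r$, $\lambda_r\mapsto\ell_r$, $\bar\mu_r\mapsto\bar m_r$, $\bar\lambda_r\mapsto\bar\ell_r$. $\phi_\Sigma=\psi_\Sigma|_{\mathbf{B}_{n,k}(\Sigma)}$, $G_\Sigma=\phi_\Sigma(\mathbf{B}_{n,k}(\Sigma))$. For $\beta\in\mathbf{B}_{0,n}(\Sigma)$, $\psi_\Sigma(\beta)=\psi_\Sigma(\iota(\beta))$ and $\bar\beta_*(\alpha)=\iota(\beta)^{-1}\alpha\,\iota(\beta)$ for $\alpha\in\mathbf{B}_{n,k}(\Sigma)$. Actions of $\mathbf{B}_{0,n}(\Sigma)$ use the convention $(\beta_1\beta_2)\cdot h=\beta_2\cdot(\beta_1\cdot h)$; an action on the set $H_\Sigma$ is induced from $\psi_\Sigma$ if it is carried over via $\psi_\Sigma$ from an action of $\mathbf{B}_{0,n}(\Sigma)$ on $\mathbf{B}_{n;k}(\Sigma)$. The two conditions, for every $\beta\in\mathbf{B}_{0,n}(\Sigma)$: (i) Lifting criteria: there is an automorphism $\beta_\sharp$ of $G_\Sigma$ with $\beta_\sharp(\phi_\Sigma(\alpha))=\phi_\Sigma(\bar\beta_*(\alpha))$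 for all $\alpha\in\mathbf{B}_{n,k}(\Sigma)$; (ii) Linearity and compatibility: $hh'(\beta\cdot1)=\beta\cdot(hh')=(\beta\cdot h)\beta_\sharp(h')$ for all $h\in H_\Sigma$, $h'\in G_\Sigma$. *)

(* Defs.v *)
From HB Require Import structures.
From mathcomp Require Import all_boot.
From mathcomp Require Import boolp.

Set Implicit Arguments.
Unset Strict Implicit.
Unset Printing Implicit Defensive.

Local Open Scope group_scope.
Local Open Scope quotient_scope.

(* MathComp's [~ x, y] is x^-1 * y^-1 * x * y; the convention here is the other
   one. *)
Definition comm (G : baseGroupType) (x y : G) : G := x * y * x^-1 * y^-1.

Inductive gterm (X : Type) : Type :=
| GOne
| GGen of X
| GMul of gterm X & gterm X
| GInv of gterm X.
Arguments GOne {X}.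

(* A baseGroupType satisfies no group law: this only gives access to the
   notations of group_scope on terms. *)
HB.instance Definition _ (X : Type) := hasMul.Build (gterm X) (@GMul X).
HB.instance Definition _ (X : Type) := hasOne.Build (gterm X) (@GOne X).
HB.instance Definition _ (X : Type) := hasInv.Build (gterm X) (@GInv X).
HB.instance Definition _ (X : Type) := gen_eqMixin (gterm X).
HB.instance Definition _ (X : Type) := gen_choiceMixin (gterm X).

Fixpoint gmap (X Y : Type) (f : X -> Y) (u : gterm X) : gterm Y :=
  match u with
  | GOne => 1
  | GGen x => GGen (f x)
  | GMul u v => gmap f u * gmap f v
  | GInv u => (gmap f u)^-1
  end.

Fixpoint geval (X : Type) (G : baseGroupType) (f : X -> G) (u : gterm X) : G :=
  match u with
  | GOne => 1
  | GGen x => f x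
  | GMul u v => geval f u * geval f v
  | GInv u => (geval f u)^-1
  end.

Section Eval.
Variables (X : Type) (G : baseGroupType) (f : X -> G).

Lemma geval1 : geval f 1 = 1. Proof. by []. Qed.
Lemma gevalG x : geval f (GGen x) = f x. Proof. by []. Qed.
Lemma gevalM u v : geval f (u * v) = geval f u * geval f v. Proof. by []. Qed.
Lemma gevalV u : geval f u^-1 = (geval f u)^-1. Proof. by []. Qed.
Lemma gevalR u v : geval f (comm u v) = comm (geval f u) (geval f v).
Proof. by []. Qed.

Definition gevalE := (gevalR, gevalM, gevalV, geval1, gevalG).

Lemma geval_map (Y : Type) (h : Y -> X) u :
  geval f (gmap h u) = geval (f \o h) u.
Proof. by elim: u => //= [u -> v ->|u ->]. Qed.

End Eval.

Section Presentation.
Variables (X : Type) (R : gterm X -> gterm X -> Prop).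

Inductive pres_eq : gterm X -> gterm X -> Prop :=
| pres_relation u v : R u v -> pres_eq u v
| pres_refl u : pres_eq u u
| pres_sym u v : pres_eq u v -> pres_eq v u
| pres_trans v u w : pres_eq u v -> pres_eq v w -> pres_eq u w
| pres_mul u u' v v' : pres_eq u u' -> pres_eq v v' -> pres_eq (u * v) (u' * v')
| pres_inv u u' : pres_eq u u' -> pres_eq u^-1 u'^-1
| pres_mulA u v w : pres_eq (u * (v * w)) (u * v * w)
| pres_mul1 u : pres_eq (1 * u) u
| pres_mulV u : pres_eq (u^-1 * u) 1.

Definition pres_eqb : rel (gterm X) := fun u v => `[< pres_eq u v >].

Lemma pres_eqb_refl : reflexive pres_eqb.
Proof. by move=> u; apply/asboolP; exact: pres_refl. Qed.
Lemma pres_eqb_sym : symmetric pres_eqb.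
Proof. by move=> u v; apply/asboolP/asboolP; exact: pres_sym. Qed.
Lemma pres_eqb_trans : transitive pres_eqb.
Proof.
by move=> v u w /asboolP uv /asboolP vw; apply/asboolP; exact: pres_trans vw.
Qed.

Canonical pres_equiv :=
  EquivRel pres_eqb pres_eqb_refl pres_eqb_sym pres_eqb_trans.

Definition presented := {eq_quot pres_equiv}.
HB.instance Definition _ := Choice.on presented.
HB.instance Definition _ := EqQuotient.on presented.

Lemma presentedP u v : \pi_presented u = \pi_presented v <-> pres_eq u v.
Proof.
split=> [/eqmodP/asboolP //|uv]; apply/eqmodP; exact/asboolP.
Qed.

Lemma pres_repr u : pres_eq (repr (\pi_presented u)) u.
Proof. by apply/presentedP; rewrite reprK. Qed.

Definition pres_mulg := lift_op2 presented (@GMul X).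
Definition pres_invg := lift_op1 presented (@GInv X).
Definition pres_oneg : presented := \pi_presented GOne.

Lemma pi_presM u v : pres_mulg (\pi_presented u) (\pi_presented v) = \pi_presented (u * v).
Proof.
by unlock pres_mulg; apply/presentedP; apply: pres_mul; exact: pres_repr.
Qed.
Lemma pi_presV u : pres_invg (\pi_presented u) = \pi_presented u^-1.
Proof.
by unlock pres_invg; apply/presentedP; apply: pres_inv; exact: pres_repr.
Qed.

Lemma pres_mulgA : associative pres_mulg.
Proof.
elim/quotW=> u; elim/quotW=> v; elim/quotW=> w.
by rewrite !pi_presM; apply/presentedP; exact: pres_mulA.
Qed.
Lemma pres_mul1g : left_id pres_oneg pres_mulg.
Proof.
by elim/quotW=> u; rewrite pi_presM; apply/presentedP; exact: pres_mul1.
Qed.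
Lemma pres_mulVg : left_inverse pres_oneg pres_invg pres_mulg.
Proof.
elim/quotW=> u; rewrite pi_presV pi_presM.
by apply/presentedP; exact: pres_mulV.
Qed.
Lemma pres_mulgV : right_inverse pres_oneg pres_invg pres_mulg.
Proof.
move=> x; rewrite -[LHS]pres_mul1g -[in LHS](pres_mulVg (pres_invg x)).
by rewrite -pres_mulgA (pres_mulgA _ x) pres_mulVg pres_mul1g pres_mulVg.
Qed.
Lemma pres_mulg1 : right_id pres_oneg pres_mulg.
Proof.
by move=> x; rewrite -(pres_mulVg x) pres_mulgA pres_mulgV pres_mul1g.
Qed.

HB.instance Definition _ := isGroup.Build presented
  pres_mulgA pres_mul1g pres_mulg1 pres_mulVg pres_mulgV.

Definition pgen (x : X) : presented := \pi_presented (GGen x).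

Lemma geval_pgen u : geval pgen u = \pi_presented u.
Proof. by elim: u => //= [u -> v ->|u ->]; [exact: pi_presM|exact: pi_presV]. Qed.

Lemma pres_ind (P : presented -> Prop) :
  (forall u, P (geval pgen u)) -> forall x, P x.
Proof. by move=> Pu x; rewrite -[x]reprK -geval_pgen. Qed.

Lemma pgen_rel u v : R u v -> geval pgen u = geval pgen v.
Proof. by move=> uv; rewrite !geval_pgen; apply/presentedP/pres_relation. Qed.

Definition respects (G : groupType) (f : X -> G) :=
  forall u v, R u v -> geval f u = geval f v.

Section Lift.
Variables (G : groupType) (f : X -> G) (fR : respects f).

Definition plift of respects f : presented -> G :=
  fun x => geval f (repr x).

Lemma geval_pres_eq u v : pres_eq u v -> geval f u = geval f v.
Proof.
elim=> //= {u v}.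
- by move=> u v w _ -> _ ->.
- by move=> u u' v v' _ -> _ ->.
- by move=> u u' _ ->.
- by move=> u v w; rewrite mulgA.
- by move=> u; rewrite mul1g.
- by move=> u; rewrite mulVg.
Qed.

Lemma plift_pi u : plift fR (\pi_presented u) = geval f u.
Proof. exact: geval_pres_eq (pres_repr u). Qed.

Lemma plift_eval u : plift fR (geval pgen u) = geval f u.
Proof. by rewrite geval_pgen plift_pi. Qed.

Lemma plift_morph : {morph plift fR : x y / x / y}.
Proof.
elim/pres_ind=> u; elim/pres_ind=> v.
by rewrite -gevalV -gevalM !plift_eval.
Qed.

HB.instance Definition _ :=
  isGroupMorphism.Build presented G (plift fR) plift_morph.

Lemma plift_gen x : plift fR (pgen x) = f x.
Proof. exact: (plift_pi (GGen x)). Qed.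

End Lift.
End Presentation.
Arguments pgen {X} R x.
Arguments plift {X R G f} fR x.

Definition subgrp (G : groupType) (S : {pred G}) : Type :=
  {x : G | x \in S}.
Definition subgrp_mk (G : groupType) (S : {pred G}) (x : G) (xS : x \in S) :
  subgrp S := exist _ x xS.
HB.instance Definition _ (G : groupType) (S : {pred G}) :=
  SubChoice.on (subgrp S).

Section SubGrp.
Variables (G : groupType) (S : groupClosed G).
Lemma subgrp_closed : group_closed (fun x : G => x \in S).
Proof. by split=> [|x y xS yS]; [exact: gpred1|exact: gpredF]. Qed.
HB.instance Definition _ :=
  SubChoice_isSubGroup.Build G (fun x : G => x \in S) (subgrp S) subgrp_closed.
End SubGrp.

Definition centralizer (G : groupType) (S : {pred G}) : {pred G} :=
  fun x => `[< forall y, y \in S -> x * y = y * x >].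

Section Centralizer.
Variables (G : groupType) (S : {pred G}).

Lemma centralizerP x :
  reflect (forall y, y \in S -> x * y = y * x) (x \in centralizer S).
Proof. exact: asboolP. Qed.

Lemma centralizerM : mulg_closed (centralizer S).
Proof.
move=> x y /centralizerP xS /centralizerP yS; apply/centralizerP=> z zS.
by rewrite -mulgA yS // !mulgA xS.
Qed.
Lemma centralizer1 : 1 \in centralizer S.
Proof. by apply/centralizerP=> z _; rewrite mulg1 mul1g. Qed.
Lemma centralizerV : invg_closed (centralizer S).
Proof.
move=> x /centralizerP xS; apply/centralizerP=> z zS.
by apply: commute_sym; apply: commuteV; rewrite /commute xS.
Qed.

HB.instance Definition _ := isMulClosed.Build G (centralizer S) centralizerM.
HB.instance Definition _ := isMul1Closed.Build G (centralizer S) centralizer1.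
HB.instance Definition _ := isInvClosed.Build G (centralizer S) centralizerV.

End Centralizer.

(* Left action of H on K by automorphisms. *)
Record autAction (H K : groupType) := AutAction {
  aut_act :> H -> K -> K;
  aut_act1 : forall x, aut_act 1 x = x;
  aut_actM : forall u v x, aut_act (u * v) x = aut_act u (aut_act v x);
  aut_act_morph : forall u, {morph aut_act u : x y / x * y}
}.

Definition sdprod (H K : groupType) of autAction H K : Type := (K * H)%type.

Section SdProd.
Variables (H K : groupType) (a : autAction H K).
Implicit Types p q : sdprod a.

HB.instance Definition _ := Choice.on (sdprod a).

Definition sd_mul p q : sdprod a := (p.1 * a p.2 q.1, p.2 * q.2).
Definition sd_one : sdprod a := (1, 1).
Definition sd_inv p : sdprod a := (a p.2^-1 p.1^-1, p.2^-1).

Lemma aut_act_one u : a u 1 = 1.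
Proof. by apply: (@mulgI _ (a u 1)); rewrite -aut_act_morph !mulg1. Qed.

Lemma sd_mulA : associative sd_mul.
Proof.
move=> [x u] [y v] [z w]; rewrite /sd_mul /=.
by rewrite aut_act_morph aut_actM !mulgA.
Qed.
Lemma sd_mul1 : left_id sd_one sd_mul.
Proof. by move=> [x u]; rewrite /sd_mul /= aut_act1 !mul1g. Qed.
Lemma sd_mulr1 : right_id sd_one sd_mul.
Proof. by move=> [x u]; rewrite /sd_mul /= aut_act_one !mulg1. Qed.
Lemma sd_mulV : left_inverse sd_one sd_inv sd_mul.
Proof.
by move=> [x u]; rewrite /sd_mul /= -aut_act_morph !mulVg aut_act_one.
Qed.
Lemma sd_mulrV : right_inverse sd_one sd_inv sd_mul.
Proof.
by move=> [x u]; rewrite /sd_mul /= -aut_actM !mulgV aut_act1 mulgV.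
Qed.

HB.instance Definition _ :=
  isGroup.Build (sdprod a) sd_mulA sd_mul1 sd_mulr1 sd_mulV sd_mulrV.

End SdProd.

Definition normal_pred (G : groupType) (S : {pred G}) :=
  forall u x, x \in S -> u * x * u^-1 \in S.

Section ConjCentralizer.
Variables (G : groupType) (S : {pred G}) (nS : normal_pred S).

Lemma conj_centralizer u (x : subgrp (centralizer S)) :
  u * val x * u^-1 \in centralizer S.
Proof.
apply/centralizerP=> y yS; have /centralizerP xS := valP x.
have := xS _ (nS u^-1 yS); rewrite invgK => xSu.
apply: (@mulgI _ u^-1); apply: (@mulIg _ u); move: xSu.
by rewrite !mulgA mulVg mul1g -!mulgA mulVg mulg1.
Qed.

Definition conj_centralizer_fun u (x : subgrp (centralizer S)) :
  subgrp (centralizer S) := subgrp_mk (conj_centralizer u x).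

Lemma conj_centralizer1 x : conj_centralizer_fun 1 x = x.
Proof. by apply: val_inj; rewrite /= mul1g invg1 mulg1. Qed.
Lemma conj_centralizerM u v x : conj_centralizer_fun (u * v) x =
  conj_centralizer_fun u (conj_centralizer_fun v x).
Proof. by apply: val_inj; rewrite /= invgM !mulgA. Qed.
Lemma conj_centralizer_morph u :
  {morph conj_centralizer_fun u : x y / x * y}.
Proof. by move=> x y; apply: val_inj; rewrite /= !mulgA mulgVK. Qed.

(* Conjugation by G on the centralizer of a normal subset of G. *)
Definition conj_centralizer_act : autAction G (subgrp (centralizer S)) :=
  AutAction conj_centralizer1 conj_centralizerM conj_centralizer_morph.

End ConjCentralizer.

(* Surface of genus g with one boundary component.  Indices start at 0: Sig i,
   Zeta t, Mu r, Lam r stand for sigma_(i+1), zeta_(t+1), mu_(r+1),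
   lambda_(r+1).  As 'I_k.-1 and 'I_m may be empty, sigma_1 and zeta_1 need not
   exist: a relation involving one of them quantifies over the ordinals of
   value 0. *)

(* Generators for k strands on the surface minus m points. *)
Inductive sbgen (g m k : nat) : Type :=
| Sig of 'I_k.-1
| Zeta of 'I_m
| Mu of 'I_g
| Lam of 'I_g.
Arguments Sig {g m k}.
Arguments Zeta {g m k}.
Arguments Mu {g m k}.
Arguments Lam {g m k}.

Section SurfaceBraid.
Variables (g m k : nat).

Local Notation "# x" := (GGen x) (at level 2, x at level 1, format "# x").
Local Notation sg i := #(Sig i).

Definition is_sig (x : sbgen g m k) := if x is Sig _ then true else false.

(* The pairs (x, y) for which x commutes with sigma_1^-1 y sigma_1. *)
Definition sb_before (x y : sbgen g m k) : bool :=
  match x, y with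
  | (Mu r | Lam r), (Mu s | Lam s) => r < s
  | (Mu _ | Lam _), Zeta _ => true
  | Zeta t, Zeta u => t < u
  | _, _ => false
  end.

Inductive sb_rel : gterm (sbgen g m k) -> gterm (sbgen g m k) -> Prop :=
| sb_far (i j : 'I_k.-1) : (i.+1 < j) || (j.+1 < i) ->
    sb_rel (comm (sg i) (sg j)) 1
| sb_braid (i j : 'I_k.-1) : (i.+1 == j :> nat) || (j.+1 == i :> nat) ->
    sb_rel (sg i * sg j * sg i) (sg j * sg i * sg j)
| sb_sig x (i : 'I_k.-1) : ~~ is_sig x -> 0 < i ->
    sb_rel (#x * sg i) (sg i * #x)
| sb_sig1 x (s1 : 'I_k.-1) : ~~ is_sig x -> s1 = 0 :> nat ->
    sb_rel (comm #x (sg s1 * #x * sg s1)) 1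
| sb_disjoint x y (s1 : 'I_k.-1) : sb_before x y -> s1 = 0 :> nat ->
    sb_rel (comm #x ((sg s1)^-1 * #y * sg s1)) 1
| sb_handle r (s1 : 'I_k.-1) : s1 = 0 :> nat ->
    sb_rel (sg s1 * #(Lam r) * sg s1 * #(Mu r) * sg s1)
           (#(Mu r) * sg s1 * #(Lam r)).

End SurfaceBraid.

Section MixedBraid.
Variables (g n k : nat).

(* X_1 + X_2: inl x is the barred generator. *)
Definition mbgen : Type := (sbgen g 0 n + sbgen g n k)%type.

Fact ltn_of_pred (i : 'I_n.-1) : i.+1 < n.
Proof. by case: i; case: n. Qed.
Definition puncture (i : 'I_n.-1) : 'I_n := widen_ord (leq_pred n) i.
Definition puncture_next (i : 'I_n.-1) : 'I_n := Ordinal (ltn_of_pred i).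

Local Notation "# x" := (GGen x) (at level 2, x at level 1, format "# x").
Local Notation T := (gterm (sbgen g n k)).

(* The word (inl x)_*(y), with z1 the index of zeta_1. *)
Definition star (z1 : 'I_n) (x : sbgen g 0 n) (y : sbgen g n k) : T :=
  let z : T := #(Zeta z1) in
  match x with
  | Sig i =>
      let a := puncture i in let b := puncture_next i in
      match y with
      | Zeta t => if t == a then #(Zeta a) * #(Zeta b) * (#(Zeta a))^-1
                  else if t == b then #(Zeta a) else #y
      | _ => #y
      end
  | Zeta _ => #y (* no such x *)
  | Mu r =>
      let m : T := #(Mu r) in
      match y with
      | Sig _ => #y
      | Zeta t => if t == z1 then m * z * m^-1 else #y
      | Mu s => if s == r then m * z * m * z^-1 * m^-1
                else if r < s then comm m z * #y * (comm m z)^-1 else #y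
      | Lam s => if s == r then #y * m * z^-1 * m^-1
                 else if r < s then comm m z * #y * (comm m z)^-1 else #y
      end
  | Lam r =>
      let l : T := #(Lam r) in
      match y with
      | Sig _ => #y
      | Zeta t => if t == z1 then l * z * l^-1 else #y
      | Mu s => if s == r then l * z * l^-1 * #y * z * l * z^-1 * l^-1
                else if r < s then comm l z * #y * (comm l z)^-1 else #y
      | Lam s => if s == r then l * z * l * z^-1 * l^-1
                 else if r < s then comm l z * #y * (comm l z)^-1 else #y
      end
  end.

Inductive mb_rel : gterm mbgen -> gterm mbgen -> Prop :=
| mb_X2 u v : sb_rel u v -> mb_rel (gmap inr u) (gmap inr v)
| mb_X1 u v : sb_rel u v -> mb_rel (gmap inl u) (gmap inl v)
| mb_conj (z1 : 'I_n) x y : z1 = 0 :> nat ->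
    mb_rel ((#(inl x))^-1 * #(inr y) * #(inl x)) (gmap inr (star z1 x y)).

(* B_{0,n} *)
Definition braid0 := presented (@sb_rel g 0 n).
(* B_{n;k} *)
Definition mbraid := presented mb_rel.
HB.instance Definition _ := Group.on braid0.
HB.instance Definition _ := Group.on mbraid.

Definition bgen1 (x : sbgen g 0 n) : mbraid := pgen mb_rel (inl x).
Definition bgen2 (y : sbgen g n k) : mbraid := pgen mb_rel (inr y).

Lemma iota_respects : respects (@sb_rel g 0 n) bgen1.
Proof.
by move=> u v /mb_X1 /pgen_rel; rewrite !geval_map.
Qed.
Definition iota : braid0 -> mbraid := plift iota_respects.
HB.instance Definition _ := UMagmaMorphism.on iota.

Definition proj_gen (x : mbgen) : braid0 :=
  match x with inl x => pgen _ x | inr _ => 1 end.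

Lemma geval_one (X : Type) (G : groupType) (f : X -> G) u :
  (forall x, f x = 1) -> geval f u = 1.
Proof.
by move=> f1; elim: u => //= [u -> v ->|u ->]; rewrite ?mulg1 ?invg1.
Qed.

Lemma proj_respects : respects mb_rel proj_gen.
Proof.
move=> _ _ [u v _|u v /pgen_rel|z1 x y _]; rewrite ?geval_map.
- by rewrite !geval_one.
- by [].
- rewrite !gevalE geval_one //=.
  by rewrite mulg1 mulVg.
Qed.
Definition proj : mbraid -> braid0 := plift proj_respects.
HB.instance Definition _ := UMagmaMorphism.on proj.

Lemma iotaK : cancel iota proj.
Proof.
elim/pres_ind=> u; rewrite /iota plift_eval.
elim: u => [|x|u IHu v IHv|u IHu].
- exact: gmulf1.
- exact: plift_gen.
- by rewrite !gevalM gmulfM /= IHu IHv.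
- by rewrite !gevalV gmulfV /= IHu.
Qed.

(* B_{n,k} is the fundamental group of the fibre of the projection; nbraidP
   below shows that it is generated by X_2. *)
Definition nbraid_pred : {pred mbraid} := [pred x | proj x == 1].

Lemma nbraid_predM : mulg_closed nbraid_pred.
Proof. by move=> x y /eqP px /eqP py; rewrite inE gmulfM /= px py mulg1. Qed.
Lemma nbraid_pred1 : 1 \in nbraid_pred.
Proof. by rewrite inE gmulf1. Qed.
Lemma nbraid_predV : invg_closed nbraid_pred.
Proof. by move=> x /eqP px; rewrite inE gmulfV /= px invg1. Qed.
HB.instance Definition _ := isMulClosed.Build mbraid nbraid_pred nbraid_predM.
HB.instance Definition _ := isMul1Closed.Build mbraid nbraid_pred nbraid_pred1.
HB.instance Definition _ := isInvClosed.Build mbraid nbraid_pred nbraid_predV.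

Lemma nbraid_normal : normal_pred nbraid_pred.
Proof.
by move=> u x /eqP px; rewrite inE !gmulfM gmulfV /= px mulg1 mulgV.
Qed.

(* B_{n,k} *)
Definition nbraid := subgrp nbraid_pred.
HB.instance Definition _ := Group.on nbraid.

Section Generation.
Hypothesis n_gt0 : 0 < n.

Let N (x : mbraid) := exists u : gterm (sbgen g n k), x = geval bgen2 u.

Let N1 : N 1. Proof. by exists 1. Qed.
Let NM x y : N x -> N y -> N (x * y).
Proof. by move=> [u ->] [v ->]; exists (u * v). Qed.
Let NV x : N x -> N x^-1.
Proof. by move=> [u ->]; exists u^-1. Qed.
Let Ng y : N (bgen2 y). Proof. by exists (GGen y). Qed.

Let z1 : 'I_n := Ordinal n_gt0.

Let conj_star x y :
  (bgen1 x)^-1 * bgen2 y * bgen1 x = geval bgen2 (star z1 x y).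
Proof.
have /pgen_rel := @mb_conj z1 x y erefl.
by rewrite geval_map.
Qed.

Let NJ x v : N v -> N ((bgen1 x)^-1 * v * bgen1 x).
Proof.
case=> u ->; elim: u => [|y|u IHu v' IHv|u IHu].
- by rewrite geval1 mulg1 mulVg.
- by rewrite gevalG conj_star; eexists.
- by have := NM IHu IHv; rewrite gevalM !mulgA mulgK.
- by have := NV IHu; rewrite gevalV !invgM invgK !mulgA.
Qed.

Let NJV x v : N v -> N (bgen1 x * v * (bgen1 x)^-1).
Proof.
pose M w := N (bgen1 x * w * (bgen1 x)^-1).
have M1 : M 1 by rewrite /M mulg1 mulgV.
have MM w w' : M w -> M w' -> M (w * w').
  by rewrite /M => Mw Mw'; have := NM Mw Mw'; rewrite !mulgA mulgVK.
have MV w : M w -> M w^-1.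
  by rewrite /M => Mw; have := NV Mw; rewrite !invgM invgK !mulgA.
have Mstar y : M (geval bgen2 (star z1 x y)).
  rewrite /M -conj_star !mulgA mulgV mul1g mulgK; exact: Ng.
have McM a b : M a -> M (a * b) -> M b.
  by move=> Ma Mab; rewrite -(mulKg a b); apply: MM => //; apply: MV.
have MMc a b : M b -> M (a * b) -> M a.
  by move=> Ma Mab; rewrite -(mulgK b a); apply: MM => //; apply: MV.
suff Mg y : M (bgen2 y).
  case=> u ->; elim: u => [|y|u IHu v' IHv|u IHu]; first exact: M1.
  - exact: Mg.
  - exact: MM.
  - exact: MV.
have fixed t : star z1 x t = GGen t -> M (bgen2 t).
  by move=> e; have := Mstar t; rewrite e.
have Mconj a y' : M a -> M (a * bgen2 y' * a^-1) -> M (bgen2 y').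
  by move=> Ma /(MMc _ _ (MV _ Ma)); apply: McM.
case: x @M M1 MM MV Mstar McM MMc fixed Mconj => [i|e|r|r] M
    M1 MM MV Mstar McM MMc fixed Mconj.
- have Mz : M (bgen2 (Zeta (puncture i))).
    have := Mstar (Zeta (puncture_next i)).
    rewrite /star ifN ?eqxx // -val_eqE /=.
    by rewrite neq_ltn ltnSn orbT.
  case: y => [j|t|s|s]; try exact: fixed.
  have [->//|ta] := eqVneq t (puncture i).
  have [->|tb] := eqVneq t (puncture_next i); last first.
    by apply: fixed; rewrite /star (negPf ta) (negPf tb).
  have := Mstar (Zeta (puncture i)); rewrite /star eqxx /=.
  exact: Mconj.
- by have := ltn_ord e.
- have Ma := Mstar (Zeta z1); have Mb := Mstar (Mu r).
  have Mc := Mstar (Lam r).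
  rewrite /star ?eqxx ?gevalE in Ma Mb Mc.
  set m := bgen2 (Mu r) in Ma Mb Mc; set z := bgen2 (Zeta z1) in Ma Mb Mc.
  have Mm : M m.
    have -> : m = (m * z * m^-1)^-1 * (m * z * m * z^-1 * m^-1)
                       * (m * z * m^-1).
      by rewrite !invgM invgK !mulgA !(mulgK, mulgVK, mulgV, mul1g).
    by apply: (MM) => //; apply: (MM) => //; apply: (MV).
  have Mz : M z by apply: (Mconj m).
  have Ml : M (bgen2 (Lam r)).
    by move: Mc => /(MMc _ _ (MV _ Mm))/(MMc _ _ (MV _ Mz))/(MMc _ _ Mm).
  have Mco : M (comm m z) by do !apply: MM => //; exact: MV.
  case: y => [j|t|s|s]; first exact: fixed.
  + have [->//|tz] := eqVneq t z1.
    by apply: fixed; rewrite /star (negPf tz).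
  + have [->//|sr] := eqVneq s r; have [rs|rs] := boolP (r < s).
      by have := Mstar (Mu s); rewrite /star (negPf sr) rs; apply: Mconj.
    by apply: fixed; rewrite /star (negPf sr) (negPf rs).
  + have [->//|sr] := eqVneq s r; have [rs|rs] := boolP (r < s).
      by have := Mstar (Lam s); rewrite /star (negPf sr) rs; apply: Mconj.
    by apply: fixed; rewrite /star (negPf sr) (negPf rs).
- have Ma := Mstar (Zeta z1); have Mb := Mstar (Lam r).
  have Mc := Mstar (Mu r).
  rewrite /star ?eqxx ?gevalE in Ma Mb Mc.
  set l := bgen2 (Lam r) in Ma Mb Mc; set z := bgen2 (Zeta z1) in Ma Mb Mc.
  have Ml : M l.
    have -> : l = (l * z * l^-1)^-1 * (l * z * l * z^-1 * l^-1)
                       * (l * z * l^-1).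
      by rewrite !invgM invgK !mulgA !(mulgK, mulgVK, mulgV, mul1g).
    by apply: (MM) => //; apply: (MM) => //; apply: (MV).
  have Mz : M z by apply: (Mconj l).
  have Mm : M (bgen2 (Mu r)).
    move: Mc => /(MMc _ _ (MV _ Ml))/(MMc _ _ (MV _ Mz))/(MMc _ _ Ml).
    by move=> /(MMc _ _ Mz); apply: (McM); apply: (MM); [exact: (MM)|exact: (MV)].
  have Mco : M (comm l z) by do !apply: MM => //; exact: MV.
  case: y => [j|t|s|s]; first exact: fixed.
  + have [->//|tz] := eqVneq t z1.
    by apply: fixed; rewrite /star (negPf tz).
  + have [->//|sr] := eqVneq s r; have [rs|rs] := boolP (r < s).
      by have := Mstar (Mu s); rewrite /star (negPf sr) rs; apply: Mconj.
    by apply: fixed; rewrite /star (negPf sr) (negPf rs).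
  + have [->//|sr] := eqVneq s r; have [rs|rs] := boolP (r < s).
      by have := Mstar (Lam s); rewrite /star (negPf sr) rs; apply: Mconj.
    by apply: fixed; rewrite /star (negPf sr) (negPf rs).
Qed.

Let NJterm (a : gterm (sbgen g 0 n)) v : N v ->
  N ((geval bgen1 a)^-1 * v * geval bgen1 a) /\
  N (geval bgen1 a * v * (geval bgen1 a)^-1).
Proof.
elim: a v => [|x|a IHa b IHb|a IHa] v Nv /=.
- by rewrite invg1 !mulg1 mul1g.
- by split; [exact: NJ|exact: NJV].
- have [aN Na] := IHa v Nv; have [bN Nb] := IHb v Nv.
  have [baN _] := IHb _ aN; have [_ Nab] := IHa _ Nb.
  by rewrite invgM; move: baN Nab; rewrite !mulgA.
- by have [? ?] := IHa v Nv; rewrite invgK.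
Qed.

Lemma nbraidP x :
  x \in nbraid_pred <-> exists u : gterm (sbgen g n k), x = geval bgen2 u.
Proof.
have projN y : N y -> proj y = 1.
  have bE u : geval bgen2 u = geval (pgen mb_rel) (gmap inr u).
    by rewrite geval_map.
  by move=> [u ->]; rewrite bE /proj plift_eval geval_map geval_one.
split=> [/eqP px|/projN/eqP //]; change (N x).
suff [a [y Ny e]] : exists a : gterm (sbgen g 0 n),
    exists2 y, N y & x = geval bgen1 a * y.
  have iE : geval bgen1 a = iota (geval (pgen _) a) by rewrite /iota plift_eval.
  move: px; rewrite e gmulfM /= (projN y Ny) iE mulg1 iotaK => ->.
  by rewrite gmulf1 mul1g.
elim/pres_ind: x {px} => u.
elim: u => [|[x|y]|u [a [y Ny e]] v [b [y' Ny' e']]|u [a [y Ny e]]].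
- by exists 1, 1; rewrite ?mulg1.
- by exists (GGen x), 1; rewrite ?mulg1.
- by exists 1, (bgen2 y); rewrite ?mul1g.
- exists (a * b), ((geval bgen1 b)^-1 * y * geval bgen1 b * y').
    by apply: NM => //; case: (NJterm b Ny).
  by rewrite !gevalM e e' !mulgA mulgK.
- exists a^-1, (geval bgen1 a * y^-1 * (geval bgen1 a)^-1).
    by case: (NJterm a (NV Ny)).
  by rewrite !gevalV e invgM !mulgA mulVg mul1g.
Qed.

End Generation.

End MixedBraid.

(* The generators q, t, \bar m_r, \bar l_r, m_r, l_r. *)
Inductive hgen (g : nat) : Type :=
| Hq
| Ht
| Hmb of 'I_g
| Hlb of 'I_g
| Hm of 'I_g
| Hl of 'I_g.
Arguments Hq {g}.
Arguments Ht {g}.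
Arguments Hmb {g}.
Arguments Hlb {g}.
Arguments Hm {g}.
Arguments Hl {g}.

Section Heisenberg.
Variables (g k : nat).

Local Notation "# x" := (GGen x) (at level 2, x at level 1, format "# x").

(* The ordered pairs of generators with a prescribed nontrivial commutator. *)
Definition h_pair (x y : hgen g) : bool :=
  match x, y with
  | Hm r, Hl s | Hmb r, Hl s | Hm r, Hlb s => r == s
  | _, _ => false
  end.

Inductive h_rel : gterm (hgen g) -> gterm (hgen g) -> Prop :=
| h_m_l r : h_rel (comm #(Hm r) #(Hl r)) (#Ht ^+ 2)
| h_mb_l r : h_rel (comm #(Hmb r) #(Hl r)) #Hq
| h_m_lb r : h_rel (comm #(Hm r) #(Hlb r)) #Hq
| h_comm x y : ~~ h_pair x y -> ~~ h_pair y x -> h_rel (comm #x #y) 1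
| h_t1 : k = 1%N -> h_rel #Ht 1.

(* H_Sigma *)
Definition heis := presented h_rel.
HB.instance Definition _ := Group.on heis.

Definition hg (x : hgen g) : heis := pgen h_rel x.

Lemma comm_commute (G : groupType) (x y : G) : comm x y = 1 <-> commute x y.
Proof.
rewrite /comm /commute; split=> [e|->]; last by rewrite mulgK mulgV.
by rewrite -[x * y](mulgVK x) -(mulgVK y (x * y / x)) e mul1g.
Qed.

Lemma comm_eq (G : groupType) (x y z : G) : comm x y = z -> x * y = z * (y * x).
Proof. by move=> <-; rewrite /comm !mulgA !mulgVK. Qed.

Lemma hC x y : ~~ h_pair x y -> ~~ h_pair y x -> commute (hg x) (hg y).
Proof. by move=> xy yx; apply/comm_commute; have /pgen_rel := h_comm xy yx. Qed.

Lemma hqC x : commute (hg Hq) (hg x). Proof. by apply: hC; case: x. Qed.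
Lemma htC x : commute (hg Ht) (hg x). Proof. by apply: hC; case: x. Qed.

Lemma h_ml r : hg (Hm r) * hg (Hl r) = hg Ht * hg Ht * (hg (Hl r) * hg (Hm r)).
Proof. by apply: comm_eq; have /pgen_rel := h_m_l r. Qed.
Lemma h_mbl r : hg (Hmb r) * hg (Hl r) = hg Hq * (hg (Hl r) * hg (Hmb r)).
Proof. by apply: comm_eq; have /pgen_rel := h_mb_l r. Qed.
Lemma h_mlb r : hg (Hm r) * hg (Hlb r) = hg Hq * (hg (Hlb r) * hg (Hm r)).
Proof. by apply: comm_eq; have /pgen_rel := h_m_lb r. Qed.

End Heisenberg.

Section Psi.
Variables (g n k : nat).
Local Notation H := (heis g k).
Local Notation h := (@hg g k).

Definition psi_gen (x : mbgen g n k) : H :=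
  match x with
  | inl (Sig _) => 1
  | inl (Zeta _) => 1 (* no such generator *)
  | inl (Mu r) => h (Hmb r)
  | inl (Lam r) => h (Hlb r)
  | inr (Sig _) => h Ht
  | inr (Zeta _) => h Hq
  | inr (Mu r) => h (Hm r)
  | inr (Lam r) => h (Hl r)
  end.

Let qC x : commute (h Hq) (h x) := hqC k x.
Let tC x : commute (h Ht) (h x) := htC k x.
Let Cq x : commute (h x) (h Hq). Proof. exact: commute_sym. Qed.
Let Ct x : commute (h x) (h Ht). Proof. exact: commute_sym. Qed.
Let comm1 (G : groupType) (x y : G) : commute x y -> comm x y = 1.
Proof. by move/comm_commute. Qed.

Let psi_X1 u v : sb_rel u v ->
  geval (psi_gen \o inl) u = geval (psi_gen \o inl) v.
Proof.
case=> {u v} [i j _|i j _|x i Nx _|x s Nx _|x y s xy _|r s _] //;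
  rewrite !gevalE /=.
- by apply: comm1.
- by rewrite mulg1 mul1g.
- by rewrite mul1g mulg1; apply: comm1.
- rewrite invg1 mul1g mulg1; apply: comm1.
  case: x y xy => [i|t|r|r] [j|u|s'|s'] //= xy; try exact: commute1;
    try exact/commute_sym/commute1; by apply: hC => //=.
- by rewrite !mul1g !mulg1; apply: hC.
Qed.

Let psi_X2 u v : sb_rel u v ->
  geval (psi_gen \o inr) u = geval (psi_gen \o inr) v.
Proof.
case=> {u v} [i j _|i j _|x i Nx _|x s Nx _|x y s xy _|r s _] //;
  rewrite !gevalE /=.
- by apply: comm1.
- by case: x Nx => //= *; exact: Ct.
- by apply: comm1; case: x Nx => //= *; do !apply: commuteM.
- apply: comm1; case: x y xy => [i|t|r|r] [j|u|s'|s'] //= xy;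
    (apply: commuteM => //; apply: commuteM => //; first exact: commuteV);
    by apply: hC => //=; rewrite -val_eqE neq_ltn xy ?orbT.
- rewrite (Ct (Hm r)) -[RHS]mulgA h_ml -(mulgA (h Ht) (h (Hl r))) (Ct (Hl r)).
  by rewrite -!mulgA (Ct (Hm r)) (mulgA (h (Hl r))) (Ct (Hl r)) -!mulgA.
Qed.

Let conj_fix (G : groupType) (x y : G) : commute y x -> x^-1 * y * x = y.
Proof. by move=> c; rewrite -mulgA c mulKg. Qed.

Let psi_X12 (z1 : 'I_n) x y :
  (psi_gen (inl x))^-1 * psi_gen (inr y) * psi_gen (inl x) =
  geval (psi_gen \o inr) (star z1 x y).
Proof.
have qF x' y' : h x' * h y' = h Hq * (h y' * h x') ->
    (h x')^-1 * h y' * h x' = h y' * (h Hq)^-1.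
  move=> e; apply: (@mulgI _ (h x')); rewrite !mulgA mulgV mul1g e.
  by rewrite (commuteM (qC y') (qC x')) mulgK.
have qF' x' y' : h y' * h x' = h Hq * (h x' * h y') ->
    (h x')^-1 * h y' * h x' = h Hq * h y'.
  move=> e; apply: (@mulgI _ (h x')); rewrite !mulgA mulgV mul1g e.
  by rewrite Cq mulgA.
have cq x' : comm (h x') (h Hq) = 1 by apply: comm1.
have simp1 x' : h x' * h Hq * h x' * (h Hq)^-1 * (h x')^-1 = h x'.
  by rewrite -(mulgA (h x')) qC !mulgA !mulgK.
have simp2 w x' : w * h x' * (h Hq)^-1 * (h x')^-1 = w * (h Hq)^-1.
  by rewrite -mulgA -invgM Cq invgM mulgA mulgK.
case: x => [i|[]//|r|r].
- rewrite /= invg1 mul1g mulg1; case: y => [j|t|s|s] //=.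
  case: ifP => _ /=; first by rewrite mulgK.
  by case: ifP.
- case: y => [j|t|s|s]; rewrite /star.
  + exact: conj_fix (tC _).
  + case: ifP => _; rewrite !gevalE /=; last exact: conj_fix (qC _).
    by rewrite Cq mulgK; apply: conj_fix (qC _).
  + have mC : commute (h (Hm s)) (h (Hmb r)) by exact: hC.
    rewrite conj_fix //; case: eqVneq => [->|_].
      by rewrite !gevalE /= simp1.
    by case: ifP => _; rewrite !gevalE ?cq ?mul1g ?invg1 ?mulg1.
  + case: eqVneq => [->|sr].
      by rewrite !gevalE /= qF ?h_mbl // simp2.
    rewrite conj_fix; last by apply: hC; rewrite //= eq_sym.
    by case: ifP => _; rewrite !gevalE ?cq ?mul1g ?invg1 ?mulg1.
- case: y => [j|t|s|s]; rewrite /star.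
  + exact: conj_fix (tC _).
  + case: ifP => _; rewrite !gevalE /=; last exact: conj_fix (qC _).
    by rewrite Cq mulgK; apply: conj_fix (qC _).
  + case: eqVneq => [->|sr].
      by rewrite !gevalE /= qF' ?h_mlb // simp2 (Cq (Hl r)) !mulgK.
    rewrite conj_fix; last by apply: hC; rewrite //= eq_sym.
    by case: ifP => _; rewrite !gevalE ?cq ?mul1g ?invg1 ?mulg1.
  + have lC : commute (h (Hl s)) (h (Hlb r)) by exact: hC.
    rewrite conj_fix //; case: eqVneq => [->|_].
      by rewrite !gevalE /= simp1.
    by case: ifP => _; rewrite !gevalE ?cq ?mul1g ?invg1 ?mulg1.
Qed.

Lemma psi_respects : respects (@mb_rel g n k) psi_gen.
Proof.
move=> _ _ [u v /psi_X2|u v /psi_X1|z1 x y _]; rewrite ?geval_map //.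
by rewrite !gevalE (psi_X12 z1).
Qed.

Definition psi : mbraid g n k -> H := plift psi_respects.
HB.instance Definition _ := UMagmaMorphism.on psi.

Lemma psi_surj : 0 < n -> 0 < k -> forall x : H, exists u, psi u = x.
Proof.
move=> n_gt0 k_gt0; elim/pres_ind; elim=> [|x|u [a ea] v [b eb]|u [a ea]].
- by exists 1; apply: gmulf1.
- have lift y : exists u, psi u = psi_gen y.
    by exists (pgen _ y); apply: plift_gen.
  case: x => [||r|r|r|r].
  + exact: (lift (inr (Zeta (Ordinal n_gt0)))).
  + have [k1|k1] := eqVneq k 1%N.
      by exists 1; rewrite gmulf1; have /pgen_rel := @h_t1 g k k1.
    have k2 : 0 < k.-1 by case: k k_gt0 k1 => [|[]].
    exact: (lift (inr (Sig (Ordinal k2)))).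
  + exact: (lift (inl (Mu r))).
  + exact: (lift (inl (Lam r))).
  + exact: (lift (inr (Mu r))).
  + exact: (lift (inr (Lam r))).
- by exists (a * b); rewrite gmulfM /= ea eb.
- by exists a^-1; rewrite gmulfV /= ea.
Qed.

(* psi(beta) stands for psi(iota(beta)) when beta is in B_{0,n}. *)
Definition psi0 (b : braid0 g n) : H := psi (iota k b).

(* phi is the restriction of psi to B_{n,k}, and G_Sigma is its image. *)
Definition phi (x : nbraid g n k) : H := psi (val x).

Definition Gsigma_pred : {pred H} := [pred x | `[< exists a, phi a = x >]].

Lemma GsigmaP x : reflect (exists a, phi a = x) (x \in Gsigma_pred).
Proof. exact: asboolP. Qed.

Lemma Gsigma_predM : mulg_closed Gsigma_pred.
Proof.
move=> _ _ /GsigmaP[a <-] /GsigmaP[b <-]; apply/GsigmaP; exists (a * b).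
by rewrite /phi valM gmulfM.
Qed.
Lemma Gsigma_pred1 : 1 \in Gsigma_pred.
Proof. by apply/GsigmaP; exists 1; rewrite /phi val1 gmulf1. Qed.
Lemma Gsigma_predV : invg_closed Gsigma_pred.
Proof.
move=> _ /GsigmaP[a <-]; apply/GsigmaP; exists a^-1.
by rewrite /phi -[RHS]gmulfV.
Qed.
HB.instance Definition _ := isMulClosed.Build H Gsigma_pred Gsigma_predM.
HB.instance Definition _ := isMul1Closed.Build H Gsigma_pred Gsigma_pred1.
HB.instance Definition _ := isInvClosed.Build H Gsigma_pred Gsigma_predV.

Definition Gsigma := subgrp Gsigma_pred.
HB.instance Definition _ := Group.on Gsigma.

Fact phi_in_Gsigma a : phi a \in Gsigma_pred.
Proof. by apply/GsigmaP; exists a. Qed.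
Definition phiG (a : nbraid g n k) : Gsigma :=
  subgrp_mk (phi_in_Gsigma a).

Lemma Gsigma_normal : 0 < n -> 0 < k -> normal_pred Gsigma_pred.
Proof.
move=> n_gt0 k_gt0 u x /GsigmaP[a <-]; have [v <-] := psi_surj n_gt0 k_gt0 u.
apply/GsigmaP.
exists (subgrp_mk (nbraid_normal v (valP a))).
by rewrite /phi /= !gmulfM gmulfV.
Qed.

(* The automorphism \bar beta_* of B_{n,k}. *)
Fact bar_star_in (b : braid0 g n) (a : nbraid g n k) :
  (iota k b)^-1 * val a * iota k b \in @nbraid_pred g n k.
Proof. by rewrite -[X in _ * X]invgK; apply/nbraid_normal/valP. Qed.
Definition bar_star (b : braid0 g n) (a : nbraid g n k) : nbraid g n k :=
  subgrp_mk (bar_star_in b a).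

(* C_{H_Sigma}(G_Sigma) *)
Definition CHG := subgrp (centralizer Gsigma_pred).
HB.instance Definition _ := Group.on CHG.

(* C_{H_Sigma}(G_Sigma) ><| H_Sigma *)
Definition CHG_sd (n_gt0 : 0 < n) (k_gt0 : 0 < k) :=
  sdprod (conj_centralizer_act (Gsigma_normal n_gt0 k_gt0)).
HB.instance Definition _ n_gt0 k_gt0 := Group.on (@CHG_sd n_gt0 k_gt0).

End Psi.
Arguments CHG_sd g {n k} n_gt0 k_gt0.

(* Action on a set, with the convention (b1 b2) . h = b2 . (b1 . h). *)
Definition is_action (B : groupType) (T : Type) (act : B -> T -> T) :=
  (forall h, act 1 h = h) /\
  (forall b1 b2 h, act (b1 * b2) h = act b2 (act b1 h)).

Definition induced_from_psi (g n k : nat)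
    (act : braid0 g n -> heis g k -> heis g k) :=
  exists2 act' : braid0 g n -> mbraid g n k -> mbraid g n k,
    is_action act' & forall b x, act b (psi x) = psi (act' b x).

Definition is_automorphism (G : groupType) (f : G -> G) :=
  {morph f : x y / x * y} /\ bijective f.

Definition lifting_criteria (g n k : nat)
    (sharp : braid0 g n -> Gsigma g n k -> Gsigma g n k) :=
  forall b, is_automorphism (sharp b) /\
    forall a, sharp b (phiG a) = phiG (bar_star b a).

Definition linear_compatible (g n k : nat)
    (act : braid0 g n -> heis g k -> heis g k)
    (sharp : braid0 g n -> Gsigma g n k -> Gsigma g n k) :=
  forall b (h : heis g k) (h' : Gsigma g n k),
    h * val h' * act b 1 = act b (h * val h') /\
    act b (h * val h') = act b h * val (sharp b h').

(* Main.v *)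
Require Import Defs.
From mathcomp Require Import all_boot.

Local Open Scope group_scope.

(** Evaluating the linearity condition at the trivial element of [Gsigma] shows
    that the action is by right translations, [act b h = h * act b 1].  Two
    consequences follow.

    - The action convention [(b1 b2) . h = b2 . (b1 . h)] turns composition into
      multiplication in the same order, so [b |-> act b 1] is multiplicative
      ([act_one_morph]).

    - The compatibility condition says that the conjugation
      [x |-> (act b 1)^-1 * x * act b 1] restricts on [Gsigma] to [sharp b].  By
      the lifting criteria the same conjugation by [psi0 k b] also restricts to
      [sharp b], because the automorphism [bar_star b] of the braid group is
      itself conjugation by [iota k b] and [psi] is a homomorphism.

    Two elements inducing the same conjugation on [Gsigma] differ by an element
    of its centralizer, so [chi b := act b 1 * (psi0 k b)^-1] takes its values
    there.  Finally, for any two homomorphisms [a] and [p] into a group, the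
    pointwise quotient [a * p^-1] is a crossed homomorphism for conjugation by
    [p]; with [a b = act b 1] and [p = psi0 k], this says that [(chi, psi0 k)] is
    multiplicative into the semidirect product. *)

Lemma psi0_morph (g n k : nat) : {morph @psi0 g n k : b1 b2 / b1 * b2}.
Proof. by move=> b1 b2; rewrite /psi0 !gmulfM. Qed.

Section TranslationAction.
Variables (g n k : nat).
Variable act : braid0 g n -> heis g k -> heis g k.
Variable sharp : braid0 g n -> Gsigma g n k -> Gsigma g n k.
Hypothesis act_linear : linear_compatible act sharp.

Lemma act_translation b h : act b h = h * act b 1.
Proof. by have [] := act_linear b h 1; rewrite val1 !mulg1 => ->. Qed.

Lemma act_one_morph :
  is_action act -> {morph (fun b => act b 1) : b1 b2 / b1 * b2}.
Proof. by move=> [_ actM] b1 b2; rewrite actM [LHS]act_translation. Qed.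

(** Conjugation by [act b 1] and conjugation by [psi0 k b] agree on [Gsigma]:
    both are [sharp b], the former by compatibility and the latter by the
    lifting criteria. *)
Lemma act_one_centralizer b : lifting_criteria sharp ->
  act b 1 * (psi0 k b)^-1 \in centralizer (@Gsigma_pred g n k).
Proof.
move=> lift; apply/centralizerP=> _ /GsigmaP[a <-].
have sharpE : val (sharp b (phiG a)) = (psi0 k b)^-1 * phi a * psi0 k b.
  by rewrite (lift b).2 /= /phi /psi0 /= !gmulfM gmulfV.
have [translate compatible] := act_linear b 1 (phiG a).
have: phi a * act b 1 = act b 1 * ((psi0 k b)^-1 * phi a * psi0 k b).
  by rewrite -sharpE -compatible -translate mul1g.
by move=> e; rewrite [RHS]mulgA e !mulgA mulgK.
Qed.

End TranslationAction.
Arguments act_translation {g n k act sharp}.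
Arguments act_one_morph {g n k act sharp}.
Arguments act_one_centralizer {g n k act sharp}.

Theorem theorem4p4 (g n k : nat) (n_gt0 : (0 < n)%N) (k_gt0 : (0 < k)%N)
    (act : braid0 g n -> heis g k -> heis g k)
    (sharp : braid0 g n -> Gsigma g n k -> Gsigma g n k)
    (act_action : is_action act)
    (act_induced : induced_from_psi act)
    (act_lifting : lifting_criteria sharp)
    (act_linear : linear_compatible act sharp) :
  exists chi : braid0 g n -> CHG g n k,
    (forall (b : braid0 g n) (h : heis g k),
       act b h = h * val (chi b) * psi0 k b) /\
    {morph (fun b : braid0 g n => (chi b, psi0 k b) : CHG_sd g n_gt0 k_gt0)
       : b1 b2 / b1 * b2}.
Proof.
exists (fun b => subgrp_mk (act_one_centralizer act_linear b act_lifting)).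
split=> [b h | b1 b2].
  by rewrite /= -mulgA mulgVK; exact: act_translation act_linear b h.
congr (_, _); last exact: psi0_morph.
apply: val_inj => /=.
rewrite psi0_morph (act_one_morph act_linear act_action).
by rewrite invgM !mulgA mulgVK.
Qed.
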